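(* Let $T$ be a $t$-norm and let $\mu$ be a fuzzy $t$-subnorm of $T$. If $\mu$ satisfies the fuzzy cancellation law, then $\mu$ satisfies the fuzzy conditional cancellation law.
   Context: A $t$-norm is a binary operation $T:[0,1]^2\to[0,1]$ that is commutative, associative, non-decreasing in each argument, and satisfies $T(x,1)=x$ for all $x\in[0,1]$. A fuzzy subset $\mu:[0,1]\to[0,1]$ is a fuzzy $t$-subnorm of $T$ if (1) $\min(\mu(x),\mu(y))\le\mu(T(x,y))$ for all $x,y\in[0,1]$, and (2) $\mu(1)=1$. It satisfies the fuzzy cancellation law if for all $x,y,z\in[0,1]$, $\mu(T(x,y))=\mu(T(x,z))$ implies $x=0$ or $y=z$. It satisfies the fuzzy conditional cancellation law if for all $x,y,z\in[0,1]$, $\mu(T(x,y))=\mu(T(x,z))>\mu(0)$ implies $\mu(y)=\mu(z)$. *)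

(* Defs.v *)
From mathcomp Require Import all_boot all_order all_algebra.
From mathcomp Require Import interval_inference reals.
Set Implicit Arguments.
Unset Strict Implicit.
Unset Printing Implicit Defensive.
Import Order.TTheory GRing.Theory Num.Theory.
Local Open Scope ring_scope.

Record tnorm (R : realType) (T : {i01 R} -> {i01 R} -> {i01 R}) : Prop := TNorm {
  tnormC : commutative T;
  tnormA : associative T;
  tnorm_monol : forall z, {homo T^~ z : x y / x <= y};
  tnorm_monor : forall z, {homo T z : x y / x <= y};
  tnormx1 : right_id 1%:i01 T
}.

Record fuzzy_tsubnorm (R : realType) (T : {i01 R} -> {i01 R} -> {i01 R})
    (mu : {i01 R} -> {i01 R}) : Prop := FuzzyTSubnorm {
  fuzzy_tsubnorm_min : forall x y, Num.min (mu x) (mu y) <= mu (T x y);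
  fuzzy_tsubnorm1 : mu 1%:i01 = 1%:i01
}.

Definition fuzzy_cancellation (R : realType)
    (T : {i01 R} -> {i01 R} -> {i01 R}) (mu : {i01 R} -> {i01 R}) : Prop :=
  forall x y z, mu (T x y) = mu (T x z) -> x = 0%:i01 \/ y = z.

Definition fuzzy_conditional_cancellation (R : realType)
    (T : {i01 R} -> {i01 R} -> {i01 R}) (mu : {i01 R} -> {i01 R}) : Prop :=
  forall x y z,
    mu (T x y) = mu (T x z) -> mu (T x z) > mu 0%:i01 -> mu y = mu z.

(* Main.v *)
Require Import Defs.
From mathcomp Require Import all_boot all_order all_algebra.
From mathcomp Require Import interval_inference reals.
Local Open Scope ring_scope.

(** Cancellation leaves two cases: [y = z], which is immediate, or [x = 0]. Since 0 annihilates
    every t-norm ([tnorm0x]), the second case contradicts the strict bound [mu (T x z) > mu 0]. *)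

Lemma i01_ge0 (R : realType) (x : {i01 R}) : 0%:i01 <= x.
Proof. by rewrite -num_le /=. Qed.

Lemma i01_le1 (R : realType) (x : {i01 R}) : x <= 1%:i01.
Proof. by rewrite -num_le /=. Qed.

(** By monotonicity and the unit law, [T 0 x <= T 0 1 = 0]. *)
Lemma tnorm0x (R : realType) (T : {i01 R} -> {i01 R} -> {i01 R}) (hT : tnorm T) :
  left_zero 0%:i01 T.
Proof.
move=> x; apply/Order.POrderTheory.le_anti; rewrite i01_ge0 andbT.
rewrite -[leRHS](tnormx1 hT); exact: tnorm_monor hT _ _ _ (i01_le1 _ _).
Qed.

Theorem proposition3p7 (R : realType) (T : {i01 R} -> {i01 R} -> {i01 R})
    (mu : {i01 R} -> {i01 R}) (hT : tnorm T) (hmu : fuzzy_tsubnorm T mu) :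
  fuzzy_cancellation T mu -> fuzzy_conditional_cancellation T mu.
Proof.
move=> hc x y z /hc[-> | -> //].
(* Case [x = 0]: the strict bound collapses to [mu 0 < mu 0]. *)
by rewrite tnorm0x // Order.POrderTheory.ltxx.
Qed.
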